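(* Let $\varepsilon>0$, let $n,L\in\mathbb{N}$ with $1\le L<n$, and let $\langle u_i\rangle_{i=1}^{n}$ be a finite sequence of real numbers. If $\langle u_i\rangle_{i=1}^{n}$ is $\varepsilon$-periodic with period $L$, then there exists a periodic sequence $\langle v_i\rangle_{i=1}^{n}$ with period $L$ satisfying $$|u_i-v_i|\le\frac{\varepsilon}{2}\qquad\text{for all } i\in\{1,\dots,n\}.$$ Conversely, if $\langle v_i\rangle_{i=1}^{n}$ is a periodic sequence with period $L$ such that $|u_i-v_i|\le\frac{\varepsilon}{2}$ for all $i\in\{1,\dots,n\}$, then $\langle u_i\rangle_{i=1}^{n}$ is $\varepsilon$-periodic with period $L$.
   Context: $\mathbb{N}=\{1,2,3,\dots\}$. A finite real sequence $\langle u_i\rangle_{i=1}^{n}$ is $\varepsilon$-periodic with period $L$ if $|u_{i+kL}-u_i|\le\varepsilon$ for all $i\in\{1,\dots,n\}$ and all $k\in\mathbb{Z}$ with $i+kL\in\{1,\dots,n\}$. It is periodic with period $L$ if $u_{i+kL}=u_i$ for all such $i,k$ (the period is not required to be minimal). *)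

(* Defs.v *)
From mathcomp Require Import all_boot all_order all_algebra reals.

Set Implicit Arguments.
Unset Strict Implicit.
Unset Printing Implicit Defensive.

Import Order.TTheory GRing.Theory Num.Theory.

Local Open Scope ring_scope.

(* A finite sequence u_1, ..., u_n is a function on 'I_n = {0, ..., n-1}, the
   ordinal of value i standing for the index i + 1.  Both definitions only
   involve differences of indices, so this shift does not affect them.
   The ordinal j is the index i + k L, computed in int as k may be negative. *)

Definition eps_periodic (R : realType) (n : nat) (eps : R) (L : nat)
    (u : 'I_n -> R) : Prop :=
  forall (i j : 'I_n) (k : int),
    (nat_of_ord j)%:Z = (nat_of_ord i)%:Z + k * L%:Z ->
    `|u j - u i| <= eps.

Definition periodic (R : realType) (n : nat) (L : nat)
    (u : 'I_n -> R) : Prop :=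
  forall (i j : 'I_n) (k : int),
    (nat_of_ord j)%:Z = (nat_of_ord i)%:Z + k * L%:Z -> u j = u i.

(* Main.v *)
Require Import Defs.
From mathcomp Require Import all_boot all_order all_algebra reals lra.

Import Order.TTheory GRing.Theory Num.Theory.

Local Open Scope ring_scope.

(** On each residue class of indices mod L the values of u lie within eps of
    their maximum; v is this maximum lowered by eps / 2. *)

(** Both notions only compare indices in the same residue class mod [L] ([modn_shiftP],
    [eps_periodicP]). So the hypothesis bounds the diameter of the values on each class by [eps],
    and the midpoint of an interval of length [eps] ending at the class maximum serves as the common
    value. Conversely, two values within [eps / 2] of a common one differ by at most [eps]. *)

Lemma modn_shiftP {L a b : nat} :
  (exists k : int, b%:Z = a%:Z + k * L%:Z) <-> b = a %[mod L].
Proof.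
split=> [[k Hk]|Hab].
  have : (b%:Z = a%:Z %[mod L%:Z])%Z by rewrite Hk addrC modzMDl.
  by rewrite !modz_nat => -[].
exists ((b %/ L)%N%:Z - (a %/ L)%N%:Z).
rewrite {1}(divn_eq b L) {1}(divn_eq a L) Hab !PoszD !PoszM mulrBl.
by rewrite addrC [RHS]addrC addrA subrK addrC.
Qed.

Lemma eps_periodicP {R : realType} {n : nat} (eps : R) (L : nat)
    (u : 'I_n -> R) :
  eps_periodic eps L u <->
  (forall i j : 'I_n, j = i %[mod L] -> `|u j - u i| <= eps).
Proof.
split=> [Hu i j /modn_shiftP [k]|Hu i j k Hk]; first exact: Hu.
by apply/Hu/modn_shiftP; exists k.
Qed.

(** The seed [i] lies in its own class, so the maximum is always attained. *)
Definition class_max {R : realType} {n : nat} (L : nat) (u : 'I_n -> R) (i : 'I_n) : R :=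
  u [arg max_(j > i | j == i %[mod L]) u j]%O.

Lemma class_maxP {R : realType} {n : nat} (L : nat) (u : 'I_n -> R) (i : 'I_n) :
  exists2 m : 'I_n, m = i %[mod L] & class_max L u i = u m /\
    forall j : 'I_n, j = i %[mod L] -> u j <= u m.
Proof.
rewrite /class_max; case: arg_maxP => // m /eqP Hm Hmax.
by exists m => //; split=> // j /eqP; apply: Hmax.
Qed.

(** The maximizing indices chosen from [i] and from [j] may differ; their values agree by
    antisymmetry, each dominating the other. *)
Lemma class_max_periodic {R : realType} {n : nat} (L : nat) (u : 'I_n -> R) :
  periodic L (class_max L u).
Proof.
move=> i j k Hk; have Hji : j = i %[mod L] by apply/modn_shiftP; exists k.
have [a Ha [-> Hamax]] := class_maxP L u i.
have [b Hb [-> Hbmax]] := class_maxP L u j.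
by apply/le_anti; rewrite Hamax ?Hbmax // ?Ha ?Hb.
Qed.

Theorem theorem4p1 (R : realType) (eps : R) (heps : 0 < eps) (n L : nat)
    (hL : (1 <= L < n)%N) (u : 'I_n -> R) :
  (eps_periodic eps L u ->
     exists v : 'I_n -> R,
       periodic L v /\ (forall i : 'I_n, `|u i - v i| <= eps / 2))
  /\
  (forall v : 'I_n -> R,
     periodic L v -> (forall i : 'I_n, `|u i - v i| <= eps / 2) ->
     eps_periodic eps L u).
Proof.
split=> [/eps_periodicP Hu|v Hv Huv i j k Hk].
  exists (fun i => class_max L u i - eps / 2); split=> [i j k Hk|i].
    by rewrite (class_max_periodic L u i j k Hk).
  have [m Hm [-> Hmax]] := class_maxP L u i.
  (* Here [u m - eps <= u i <= u m], an interval centred at [u m - eps / 2]. *)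
  move: (Hu _ _ Hm) (Hmax i erefl); rewrite !ler_norml => /andP[_ H1] H2.
  by apply/andP; split; lra.
move: (Huv i) (Huv j); rewrite (Hv i j k Hk) !ler_norml.
by move=> /andP[H1 H2] /andP[H3 H4]; apply/andP; split; lra.
Qed.
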